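(* Let $A_1=[x_1,y_1]$, $A_2=[x_2,y_2]$, $A_3=[x_3,y_3]$ be three distinct non-collinear points of the plane over a field of characteristic not two. For $m=1,2,3$ let $b_m^b,b_m^r,b_m^g$ be respectively the blue, red and green perpendicular bisectors of the side of the triangle opposite to $A_m$. Then the three blue perpendicular bisectors $b_1^b,b_2^b,b_3^b$ meet in a point $C_b$, the three red perpendicular bisectors $b_1^r,b_2^r,b_3^r$ meet in a point $C_r$, and the three green perpendicular bisectors $b_1^g,b_2^g,b_3^g$ meet in a point $C_g$, and these points are given by $$C_b=\left[\frac{[x_1^2y_2]^-+[y_1^2y_2]^-}{2[x_1y_2]^-},\ \frac{[x_1y_2^2]^-+[x_1x_2^2]^-}{2[x_1y_2]^-}\right],$$ $$C_r=\left[\frac{[x_1^2y_2]^--[y_1^2y_2]^-}{2[x_1y_2]^-},\ \frac{[x_1y_2^2]^--[x_1x_2^2]^-}{2[x_1y_2]^-}\right],$$ $$C_g=\left[\frac{[x_1x_2y_2]^-}{[x_1y_2]^-},\ \frac{[x_1y_1y_2]^-}{[x_1y_2]^-}\right].$$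
   Context: Work over a fixed field not of characteristic two. A point is an ordered pair $[x,y]$ of field elements. A line is a proportion $\langle a:b:c\rangle$ with $a,b$ not both zero; the point $[x,y]$ lies on it precisely when $ax+by+c=0$. Lines $\langle a_1:b_1:c_1\rangle$ and $\langle a_2:b_2:c_2\rangle$ are blue perpendicular when $a_1a_2+b_1b_2=0$, red perpendicular when $a_1a_2-b_1b_2=0$, and green perpendicular when $a_1b_2+b_1a_2=0$. For each colour, the perpendicular bisector of that colour of a side $\overline{BC}$ (with $B\neq C$) is the unique line through the midpoint of $B$ and $C$ which is perpendicular to the line $BC$ in that colour. The side opposite to $A_1$ is $\overline{A_2A_3}$, and so on. For a monomial $m$ in variables $x_i,y_i$ with indices in $\{1,2,3\}$, $[m]^-$ denotes the sum over all six permutations $\sigma$ of $\{1,2,3\}$ of $\operatorname{sgn}(\sigma)$ times the monomial obtained from $m$ by applying $\sigma$ to the indices; e.g. $[x_1y_2]^-=x_1y_2-x_1y_3+x_2y_3-x_3y_2+x_3y_1-x_2y_1$, which is nonzero when the points are non-collinear. *)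

(* Defs.v *)
From HB Require Import structures.
From mathcomp Require Import all_boot all_order all_algebra all_fingroup.
From mathcomp Require Import generic_quotient ring.

Set Implicit Arguments.
Unset Strict Implicit.
Unset Printing Implicit Defensive.

Import GRing.Theory.
Local Open Scope ring_scope.
Local Open Scope quotient_scope.

Notation point F := (F * F)%type (only parsing).

Section Lines.
Variable F : fieldType.
Implicit Types (P B C : point F).

Definition coefs := {t : F * F * F | (t.1.1 != 0) || (t.1.2 != 0)}.
Implicit Types (t u v : coefs).

Definition ca t : F := (val t).1.1.
Definition cb t : F := (val t).1.2.
Definition cc t : F := (val t).2.

(* As (a, b) <> (0, 0), two triples are proportional if and only if all the
   2 x 2 minors vanish. *)
Definition prop_rel t u : bool :=
  [&& ca t * cb u == ca u * cb t,
      ca t * cc u == ca u * cc t & cb t * cc u == cb u * cc t].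

Lemma prop_relP t u :
  reflect (exists2 k : F, k != 0 & val u = (k * ca t, k * cb t, k * cc t))
          (prop_rel t u).
Proof.
apply: (iffP and3P) => [[/eqP h1 /eqP h2 /eqP h3]|[k k0 e]]; last first.
  by rewrite /ca /cb /cc e /=; split; apply/eqP; rewrite /ca /cb /cc; ring.
move: t u h1 h2 h3 => [[[a b] c] /= ht] [[[a' b'] c'] /= hu].
rewrite /ca /cb /cc /= => h1 h2 h3.
case: (eqVneq a 0) ht => [a0|a0] /= ht.
  have a'0 : a' = 0.
    by apply/eqP; move/esym/eqP: h1; rewrite a0 mul0r mulf_eq0 (negPf ht) orbF.
  have b'0 : b' != 0 by move: hu; rewrite a'0 eqxx.
  exists (b' / b); first by rewrite mulf_neq0 ?invr_eq0.
  rewrite a0 a'0 mulr0 divfK //; congr (_, _, _).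
  by apply: (mulfI ht); rewrite h3; field.
have a'0 : a' != 0.
  apply/eqP => a'0; move/eqP: h1; rewrite a'0 mul0r mulf_eq0 (negPf a0) /=.
  by move=> /eqP b'0; move: hu; rewrite a'0 b'0 eqxx.
exists (a' / a); first by rewrite mulf_neq0 ?invr_eq0.
rewrite divfK //; congr (_, _, _); apply: (mulfI a0).
  by rewrite h1; field.
by rewrite h2; field.
Qed.

Lemma prop_rel_refl : reflexive prop_rel.
Proof. by move=> t; rewrite /prop_rel !eqxx. Qed.

Lemma prop_rel_sym : symmetric prop_rel.
Proof.
by move=> t u; rewrite /prop_rel [ca t * cb u == _]eq_sym
  [ca t * cc u == _]eq_sym [cb t * cc u == _]eq_sym.
Qed.

Lemma prop_rel_trans : transitive prop_rel.
Proof.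
move=> u t v /prop_relP[k k0 e] /prop_relP[l l0 e']; apply/prop_relP.
exists (l * k); first by rewrite mulf_neq0.
by rewrite e' /ca /cb /cc e /= !mulrA.
Qed.

Canonical prop_equiv :=
  EquivRel prop_rel prop_rel_refl prop_rel_sym prop_rel_trans.

Definition line := {eq_quot prop_equiv}.
Implicit Types (k l : line).

Definition proportion (a b c : F) (h : (a != 0) || (b != 0)) : line :=
  \pi_line (exist _ (a, b, c) h : coefs).

(* Read on a representative; independence from the choice is
   lies_on_proportion and perpendicular_proportion. *)
Definition lies_on P l : bool :=
  ca (repr l) * P.1 + cb (repr l) * P.2 + cc (repr l) == 0.

Inductive colour := Blue | Red | Green.

Definition perpendicular (col : colour) l k : bool :=
  let: (a1, b1) := (ca (repr l), cb (repr l)) in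
  let: (a2, b2) := (ca (repr k), cb (repr k)) in
  match col with
  | Blue  => a1 * a2 + b1 * b2 == 0
  | Red   => a1 * a2 - b1 * b2 == 0
  | Green => a1 * b2 + b1 * a2 == 0
  end.

Lemma repr_proportion a b c h :
  exists2 k : F, k != 0 &
    val (repr (@proportion a b c h)) = (k * a, k * b, k * c).
Proof.
have /eqmodP/= := reprK (proportion c h).
by rewrite prop_rel_sym => /prop_relP[k k0 ->]; exists k.
Qed.

Lemma lies_on_proportion P a b c h :
  lies_on P (@proportion a b c h) = (a * P.1 + b * P.2 + c == 0).
Proof.
have [k k0 e] := repr_proportion c h.
by rewrite /lies_on /ca /cb /cc e /= -!mulrA -!mulrDr mulf_eq0 (negPf k0).
Qed.

Lemma perpendicular_proportion col a1 b1 c1 h1 a2 b2 c2 h2 :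
  perpendicular col (@proportion a1 b1 c1 h1) (@proportion a2 b2 c2 h2) =
  match col with
  | Blue  => a1 * a2 + b1 * b2 == 0
  | Red   => a1 * a2 - b1 * b2 == 0
  | Green => a1 * b2 + b1 * a2 == 0
  end.
Proof.
have [k k0 e] := repr_proportion c1 h1; have [l l0 f] := repr_proportion c2 h2.
have kl0 : k * l != 0 by rewrite mulf_neq0.
rewrite /perpendicular /ca /cb /cc e f /=.
by case: col; rewrite -[RHS]orFb -(negPf kl0) -mulf_eq0;
  congr (_ == _); ring.
Qed.

Lemma line_proportion l : exists a b c h, l = @proportion a b c h.
Proof.
case e: (repr l) => [[[a b] c] h]; exists a, b, c, h.
by rewrite /proportion -e reprK.
Qed.

Lemma eq_proportion a b c h a' b' c' h' :
  a * b' = a' * b -> a * c' = a' * c -> b * c' = b' * c ->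
  @proportion a b c h = @proportion a' b' c' h'.
Proof.
by move=> h1 h2 h3; apply/eqmodP; apply/and3P; split; apply/eqP.
Qed.

Lemma eq_line_through P a b c h a' b' c' h' :
  lies_on P (@proportion a b c h) -> lies_on P (@proportion a' b' c' h') ->
  a * b' = a' * b -> @proportion a b c h = @proportion a' b' c' h'.
Proof.
rewrite !lies_on_proportion => /eqP e /eqP e' ab; apply: eq_proportion => //.
  apply/subr0_eq; transitivity (a * (a' * P.1 + b' * P.2 + c')
    - a' * (a * P.1 + b * P.2 + c) - (a * b' - a' * b) * P.2); first by ring.
  by rewrite e e' ab; ring.
apply/subr0_eq; transitivity (b * (a' * P.1 + b' * P.2 + c')
  - b' * (a * P.1 + b * P.2 + c) + (a * b' - a' * b) * P.1); first by ring.
by rewrite e e' ab; ring.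
Qed.

Lemma join_subproof B C : B != C -> (B.2 - C.2 != 0) || (C.1 - B.1 != 0).
Proof.
apply: contraNT; rewrite negb_or !negbK !subr_eq0 => /andP[/eqP e2 /eqP e1].
by apply/eqP; case: B C e1 e2 => [? ?] [? ?] /= -> ->.
Qed.

Lemma joinP B C (h : B != C) k : lies_on B k -> lies_on C k ->
  k = proportion (B.1 * C.2 - C.1 * B.2) (join_subproof h).
Proof.
have [a [b [c [h' ->]]]] := line_proportion k => onB onC.
apply: (eq_line_through onB); first by rewrite lies_on_proportion; apply/eqP; ring.
move: onB onC; rewrite !lies_on_proportion => /eqP e1 /eqP e2.
apply/subr0_eq; transitivity ((a * C.1 + b * C.2 + c) - (a * B.1 + b * B.2 + c));
  first by ring.
by rewrite e1 e2 subrr.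
Qed.

Lemma join_unique B C : B != C -> exists! k, lies_on B k /\ lies_on C k.
Proof.
move=> h; exists (proportion (B.1 * C.2 - C.1 * B.2) (join_subproof h)); split.
  by rewrite !lies_on_proportion; split; apply/eqP; ring.
by move=> k [onB onC]; rewrite (joinP h onB onC).
Qed.

Definition midpoint B C : point F := ((B.1 + C.1) / 2, (B.2 + C.2) / 2).

(* Only meaningful for B <> C; the line BC is then the only k through B and C
   by join_unique, and there is exactly one such l by perp_bisector_unique. *)
Definition is_perp_bisector (col : colour) B C l : Prop :=
  lies_on (midpoint B C) l /\
  exists k, [/\ lies_on B k, lies_on C k & perpendicular col l k].

Lemma perp_bisector_unique col B C : B != C ->
  exists! l, is_perp_bisector col B C l.
Proof.
move=> h; set M := midpoint B C.
pose a := B.2 - C.2; pose b := C.1 - B.1.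
pose p := match col with Green => a | _ => b end.
pose q := match col with Blue => - a | Red => a | Green => - b end.
have hpq : (p != 0) || (q != 0).
  have := join_subproof h; rewrite -/a -/b /p /q.
  by case: (col); rewrite ?oppr_eq0 // orbC.
have onM : lies_on M (proportion (- (p * M.1 + q * M.2)) hpq).
  by rewrite lies_on_proportion subrr.
exists (proportion (- (p * M.1 + q * M.2)) hpq); split.
  split=> //; have [k [[onB onC] _]] := join_unique h; exists k; split=> //.
  rewrite (joinP h onB onC) perpendicular_proportion -/a -/b /p /q.
  by case: (col); apply/eqP; ring.
move=> l [onMl [k [onB onC]]]; rewrite (joinP h onB onC) -/a -/b.
have [a' [b' [c' [h' el]]]] := line_proportion l; move: onMl; rewrite el => onMl.
rewrite perpendicular_proportion -/a -/b => pe; apply: (eq_line_through onM onMl).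
apply/subr0_eq; move: pe; rewrite /p /q; case: (col) => /eqP pe.
- by rewrite -[RHS]pe; ring.
- by rewrite -[RHS]oppr0 -[in RHS]pe; ring.
- by rewrite -[RHS]pe; ring.
Qed.

Definition collinear B C P : Prop :=
  exists k, [/\ lies_on B k, lies_on C k & lies_on P k].

(* P is the one and only common point of the three lines. *)
Definition meet_in l1 l2 l3 P : Prop :=
  forall Q, [/\ lies_on Q l1, lies_on Q l2 & lies_on Q l3] <-> Q = P.

End Lines.

Arguments proportion {F} a b c h.

Definition i1 : 'I_3 := @Ordinal 3 0 isT.
Definition i2 : 'I_3 := @Ordinal 3 1 isT.
Definition i3 : 'I_3 := @Ordinal 3 2 isT.

(* [m]^-, a monomial m in the x_i, y_i being represented by its evaluation
   function; x \o s has i-th entry x (s i), so s is applied to the indices. *)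
Definition alt (F : fieldType) (x y : 'I_3 -> F)
    (m : ('I_3 -> F) -> ('I_3 -> F) -> F) : F :=
  \sum_(s : 'S_3) (-1) ^+ s * m (x \o s) (y \o s).

Definition perms3 : seq 'S_3 :=
  [:: 1%g; tperm i1 i2; tperm i1 i3; tperm i2 i3;
      (tperm i1 i2 * tperm i2 i3)%g; (tperm i2 i3 * tperm i1 i2)%g].

Lemma perm_eq_perms3 : perm_eq (index_enum 'S_3) perms3.
Proof.
have u : uniq perms3.
  apply: (@map_uniq _ _ (fun s : 'S_3 => [:: val (s i1); val (s i2); val (s i3)])).
  by rewrite /= !permM ?permE /= ?permE /=.
apply: (@seq.uniq_perm {perm 'I_3} _ _ _ u); first exact: index_enum_uniq.
move=> s; rewrite mem_index_enum; apply/esym.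
have /(_ s) : perms3 =i 'S_3.
  apply/subset_cardP; last by apply/subsetP.
  by rewrite (card_uniqP u) card_Sn.
by [].
Qed.

Lemma alt_x1y2 (F : fieldType) (x y : 'I_3 -> F) :
  alt x y (fun x y => x i1 * y i2) =
  x i1 * y i2 - x i1 * y i3 + x i2 * y i3 - x i3 * y i2
  + x i3 * y i1 - x i2 * y i1.
Proof.
rewrite /alt (perm_big _ perm_eq_perms3) /= !big_cons big_nil /=.
rewrite !odd_permM !odd_tperm odd_perm1 /= !permM ?permE /= ?permE /=.
by ring.
Qed.

(* Main.v *)
(* With d = C - B, the bisector of BC in each colour is the set of the Q with
   n . (2 Q - B - C) = 0, for n the image of d under a linear map.  The three
   such equations of a triangle sum to zero, and the determinant of any two of
   them is, up to sign, [x_1 y_2]^-, which vanishes only for collinear points;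
   Cramer's rule then yields the common point. *)
Require Import Defs.
From mathcomp Require Import all_boot all_order all_algebra all_fingroup.
From mathcomp Require Import ring.

Set Implicit Arguments.
Unset Strict Implicit.
Unset Printing Implicit Defensive.

Import GRing.Theory.
Local Open Scope ring_scope.

(** A permutation of three indices is determined by its values at [i1] and [i2], so the six terms
    are indexed by the ordered pairs of distinct indices. Every bracket of the theorem has this
    shape. *)
Lemma alt_pair (F : fieldType) (x y : 'I_3 -> F) (f : F -> F -> F -> F -> F) :
  let g i j := f (x i) (y i) (x j) (y j) in
  alt x y (fun x y => f (x i1) (y i1) (x i2) (y i2)) =
  g i1 i2 - g i1 i3 + g i2 i3 - g i3 i2 + g i3 i1 - g i2 i1.
Proof.
rewrite /alt (perm_big _ perm_eq_perms3) /= !big_cons big_nil /=.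
rewrite !odd_permM !odd_tperm odd_perm1 /= !permM ?permE /= ?permE /=.
by ring.
Qed.

Section Bisectors.
Variable F : fieldType.
Implicit Types (B C P Q d : point F).

(** The Gram matrix of the quadratic form $q$ of the colour, namely $x^2+y^2$, $x^2-y^2$ or $2xy$,
    applied to [d]. *)
Definition bisector_normal (col : colour) d : point F :=
  match col with
  | Blue  => (d.1, d.2)
  | Red   => (d.1, - d.2)
  | Green => (d.2, d.1)
  end.

(** This equals $q(Q-B)-q(Q-C)$: the bisector is the locus equidistant from [B] and [C] for $q$, and
    the three forms of a triangle telescope. *)
Definition bisector_form (col : colour) B C Q : F :=
  let n := bisector_normal col (C.1 - B.1, C.2 - B.2) in
  n.1 * (2 * Q.1 - B.1 - C.1) + n.2 * (2 * Q.2 - B.2 - C.2).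

Lemma lies_on_perp_bisector (charF : 2%N \notin [pchar F]) col B C l Q :
  B != C -> is_perp_bisector col B C l ->
  lies_on Q l = (bisector_form col B C Q == 0).
Proof.
move=> neqBC [onM [k [onB onC]]].
have two0 : 2 != 0 :> F by move: charF; rewrite inE.
rewrite (joinP neqBC onB onC).
set n := bisector_normal col (C.1 - B.1, C.2 - B.2).
have hn : (n.1 != 0) || (n.2 != 0).
  have := join_subproof neqBC; rewrite -(oppr_eq0 (B.2 - C.2)) opprB /n orbC.
  by case: (col); rewrite //= ?oppr_eq0 // orbC.
pose M := midpoint B C; pose l' := proportion _ _ (- (n.1 * M.1 + n.2 * M.2)) hn.
have [a [b [c [h def_l]]]] := line_proportion l; rewrite def_l in onM *.
have onM' : lies_on M l' by rewrite lies_on_proportion subrr.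
rewrite perpendicular_proportion => perp.
rewrite (eq_line_through (h' := hn) onM onM'); last first.
  (* Up to sign, perpendicularity to the line [BC] says that $(a,b)$ is proportional to [n]; both
     lines pass through the midpoint, so they coincide. *)
  apply/subr0_eq; rewrite /n; case: (col) perp => /= /eqP perp.
  - by rewrite -[RHS]oppr0 -[in RHS]perp; ring.
  - by rewrite -[RHS]perp; ring.
  - by rewrite -[RHS]perp; ring.
rewrite lies_on_proportion -[LHS]orFb -(negPf two0) -mulf_eq0.
by congr (_ == 0); rewrite /bisector_form -/n /M /midpoint /=; field.
Qed.

Definition area2 P B C : F :=
  (B.1 - P.1) * (C.2 - P.2) - (C.1 - P.1) * (B.2 - P.2).

(** The equation of the line [PB], evaluated at [C], is exactly [area2 P B C]. *)
Lemma area2_neq0 P B C : P != B -> ~ collinear P B C -> area2 P B C != 0.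
Proof.
move=> neqPB ncol; apply/eqP => area0; apply: ncol.
exists (proportion _ _ (P.1 * B.2 - B.1 * P.2) (join_subproof neqPB)).
rewrite !lies_on_proportion; split; apply/eqP; [by ring|by ring|].
by rewrite -[RHS]area0 /area2; ring.
Qed.

(** The Gram matrix has determinant $1$ for blue and $-1$ for red and green. *)
Lemma bisector_normal_det col d e :
  let n := bisector_normal col d in let m := bisector_normal col e in
  (n.1 * m.2 - m.1 * n.2 == 0) = (d.1 * e.2 - e.1 * d.2 == 0).
Proof.
rewrite /=; case: col => //=; rewrite -[RHS]oppr_eq0; congr (_ == 0); ring.
Qed.

Lemma bisectors_meet_in (charF : 2%N \notin [pchar F]) col P B C lP lB lC Z :
    P != B -> B != C -> C != P -> area2 P B C != 0 ->
    is_perp_bisector col B C lP -> is_perp_bisector col C P lB ->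
    is_perp_bisector col P B lC ->
    bisector_form col B C Z = 0 -> bisector_form col C P Z = 0 ->
  meet_in lP lB lC Z.
Proof.
move=> neqPB neqBC neqCP area0 hP hB hC onP onB Q.
have two0 : 2 != 0 :> F by move: charF; rewrite inE.
rewrite (lies_on_perp_bisector charF _ neqBC hP).
rewrite (lies_on_perp_bisector charF _ neqCP hB).
rewrite (lies_on_perp_bisector charF _ neqPB hC).
split=> [[/eqP onP' /eqP onB' _]|->]; last first.
  rewrite onP onB eqxx; split=> //; apply/eqP.
  transitivity (- (bisector_form col B C Z + bisector_form col C P Z)).
    by rewrite /bisector_form; case: (col) => /=; ring.
  by rewrite onP onB addr0 oppr0.
(* Uniqueness: $Q-Z$ solves the homogeneous system with rows [n] and [m], whose determinant is the
   nonzero [area2 P B C] up to sign. *)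
pose n := bisector_normal col (C.1 - B.1, C.2 - B.2).
pose m := bisector_normal col (P.1 - C.1, P.2 - C.2).
have det0 : n.1 * m.2 - m.1 * n.2 != 0.
  rewrite bisector_normal_det /=; apply: contraNneq area0 => det0.
  by rewrite -[X in _ == X]det0 /area2; apply/eqP; ring.
have eqn0 : n.1 * (Q.1 - Z.1) + n.2 * (Q.2 - Z.2) = 0.
  apply: (mulfI two0); rewrite mulr0.
  transitivity (bisector_form col B C Q - bisector_form col B C Z).
    by rewrite /bisector_form -/n; ring.
  by rewrite onP' onP subrr.
have eqm0 : m.1 * (Q.1 - Z.1) + m.2 * (Q.2 - Z.2) = 0.
  apply: (mulfI two0); rewrite mulr0.
  transitivity (bisector_form col C P Q - bisector_form col C P Z).
    by rewrite /bisector_form -/m; ring.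
  by rewrite onB' onB subrr.
rewrite (surjective_pairing Q) (surjective_pairing Z).
congr (_, _); apply/subr0_eq/(mulfI det0); rewrite mulr0.
  transitivity (m.2 * (n.1 * (Q.1 - Z.1) + n.2 * (Q.2 - Z.2))
    - n.2 * (m.1 * (Q.1 - Z.1) + m.2 * (Q.2 - Z.2))); first by ring.
  by rewrite eqn0 eqm0 !mulr0 subrr.
transitivity (n.1 * (m.1 * (Q.1 - Z.1) + m.2 * (Q.2 - Z.2))
  - m.1 * (n.1 * (Q.1 - Z.1) + n.2 * (Q.2 - Z.2))); first by ring.
by rewrite eqn0 eqm0 !mulr0 subrr.
Qed.

End Bisectors.

Theorem theorem14 (F : fieldType) (charF : 2%N \notin [pchar F])
    (x y : 'I_3 -> F) (A : 'I_3 -> point F)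
    (defA : forall m, A m = (x m, y m))
    (distinct : injective A)
    (noncollinear : ~ collinear (A i1) (A i2) (A i3))
    (b : colour -> 'I_3 -> line F)
    (b1 : forall col, is_perp_bisector col (A i2) (A i3) (b col i1))
    (b2 : forall col, is_perp_bisector col (A i3) (A i1) (b col i2))
    (b3 : forall col, is_perp_bisector col (A i1) (A i2) (b col i3)) :
  let br := alt x y in
  [/\ meet_in (b Blue i1) (b Blue i2) (b Blue i3)
        ((br (fun x y => x i1 ^+ 2 * y i2) + br (fun x y => y i1 ^+ 2 * y i2))
           / (2 * br (fun x y => x i1 * y i2)),
         (br (fun x y => x i1 * y i2 ^+ 2) + br (fun x y => x i1 * x i2 ^+ 2))
           / (2 * br (fun x y => x i1 * y i2))),
      meet_in (b Red i1) (b Red i2) (b Red i3)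
        ((br (fun x y => x i1 ^+ 2 * y i2) - br (fun x y => y i1 ^+ 2 * y i2))
           / (2 * br (fun x y => x i1 * y i2)),
         (br (fun x y => x i1 * y i2 ^+ 2) - br (fun x y => x i1 * x i2 ^+ 2))
           / (2 * br (fun x y => x i1 * y i2)))
    & meet_in (b Green i1) (b Green i2) (b Green i3)
        (br (fun x y => x i1 * x i2 * y i2) / br (fun x y => x i1 * y i2),
         br (fun x y => x i1 * y i1 * y i2) / br (fun x y => x i1 * y i2))].
Proof.
move=> br.
have two0 : 2 != 0 :> F by move: charF; rewrite inE.
have neqA i j : i != j -> A i != A j by apply: contraNneq => /distinct ->.
have area_br : area2 (A i1) (A i2) (A i3) = br (fun x y => x i1 * y i2).
  by rewrite /br alt_x1y2 /area2 !defA /=; ring.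
have area0 : area2 (A i1) (A i2) (A i3) != 0 by apply: area2_neq0; rewrite ?neqA.
have br0 := area0; rewrite area_br /br alt_x1y2 in br0.
rewrite /br alt_x1y2.
rewrite (alt_pair x y (fun a _ _ d => a ^+ 2 * d)).
rewrite (alt_pair x y (fun _ b _ d => b ^+ 2 * d)).
rewrite (alt_pair x y (fun a _ _ d => a * d ^+ 2)).
rewrite (alt_pair x y (fun a _ c _ => a * c ^+ 2)).
rewrite (alt_pair x y (fun a _ c d => a * c * d)).
rewrite (alt_pair x y (fun a b _ d => a * b * d)).
(* For each colour it remains to check that the stated point is a zero of two bisector forms, a
   rational identity whose denominators involve only $2$ and $[x_1y_2]^-$. *)
by split; apply: (bisectors_meet_in charF _ _ _ area0 (b1 _) (b2 _) (b3 _));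
  rewrite ?neqA // /bisector_form !defA /=; field; rewrite ?br0 ?two0.
Qed.
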